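(* There exists a constant $c$ such that, for any $n \in \mathbb{N}$ and any $(\frac{1}{2}, \lambda)$-pseudo-random graph $G$ on $N$ vertices with $\lambda \leq 2^{-c n \log n} N$, in every 2-edge-coloring of $G$, every graph on $n$ vertices occurs as an induced monochromatic copy. Moreover, in any given 2-edge-coloring of $G$, all of these induced monochromatic copies can be found in the same color.
   Context: For subsets $A,B$ of the vertex set of a graph, $d(A,B)=e(A,B)/(|A||B|)$ denotes the fraction of pairs $(a,b)\in A\times B$ that are edges. A graph $G=(V,E)$ is $(p,\lambda)$-pseudo-random if for all (nonempty) subsets $A,B \subseteq V$, $|d(A,B)-p| \leq \lambda/\sqrt{|A||B|}$. An induced monochromatic copy of a graph $H$ in an edge-colored graph $G$ is an induced subgraph of $G$ isomorphic to $H$ all of whose edges have the same color. Logarithms are to base $2$. *)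

(* Defs.v *)
From mathcomp Require Import all_boot all_order all_algebra.
From mathcomp Require Import reals exp.

Set Implicit Arguments.
Unset Strict Implicit.
Unset Printing Implicit Defensive.

Import Order.TTheory GRing.Theory Num.Theory.
Local Open Scope ring_scope.

Record sgraph := SGraph {
  vertex :> finType;
  adj : rel vertex;
  adj_sym : symmetric adj;
  adj_irrefl : irreflexive adj }.

Section Induced.
Variables (G : sgraph) (S : {set G}).

Definition induced_adj : rel {x : G | x \in S} :=
  fun u v => adj (val u) (val v).

Lemma induced_adj_sym : symmetric induced_adj.
Proof. by move=> u v; apply: adj_sym. Qed.

Lemma induced_adj_irrefl : irreflexive induced_adj.
Proof. by move=> u; apply: adj_irrefl. Qed.

Definition induced : sgraph := SGraph induced_adj_sym induced_adj_irrefl.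

End Induced.

Definition isomorphic (G H : sgraph) : Prop :=
  exists2 f : G -> H, bijective f & forall x y, adj (f x) (f y) = adj x y.

(* Ordered pairs are counted, so an edge inside A :&: B contributes twice. *)
Definition edge_pairs (G : sgraph) (A B : {set G}) : nat :=
  #|[set ab in setX A B | adj ab.1 ab.2]|.

Definition density (R : realType) (G : sgraph) (A B : {set G}) : R :=
  (edge_pairs A B)%:R / (#|A| * #|B|)%:R.

Definition pseudo_random (R : realType) (p lambda : R) (G : sgraph) : Prop :=
  forall A B : {set G}, A != set0 -> B != set0 ->
    `|density R A B - p| <= lambda / Num.sqrt (#|A| * #|B|)%:R.

(* The edge xy is encoded as the set [set x; y]; the values of a coloring on
   sets that are not edges are never inspected. *)
Definition edge_2coloring (G : sgraph) : Type := {set G} -> bool.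

(* An edgeless set is monochromatic in both colors. *)
Definition mono_in (G : sgraph) (col : edge_2coloring G) (k : bool)
    (S : {set G}) : Prop :=
  forall x y, x \in S -> y \in S -> adj x y -> col [set x; y] = k.

Definition induced_mono_copy_in (G : sgraph) (col : edge_2coloring G)
    (k : bool) (H : sgraph) : Prop :=
  exists2 S : {set G}, isomorphic (induced S) H & mono_in col k S.

Definition induced_mono_copy (G : sgraph) (col : edge_2coloring G)
    (H : sgraph) : Prop :=
  exists k : bool, induced_mono_copy_in col k H.

Definition log2 (R : realType) (x : R) : R := ln x / ln 2.

(* Main.v *)
Require Import Defs.
From mathcomp Require Import all_boot all_order all_algebra.
From mathcomp Require Import reals exp.
From mathcomp Require Import ring lra zify.

Set Implicit Arguments.
Unset Strict Implicit.
Unset Printing Implicit Defensive.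

Import Order.TTheory GRing.Theory Num.Theory.
Local Open Scope ring_scope.

(** Write [n = 2 ^ h] for a power of two above the number of vertices of [H],
    and call [e]-capacity [d] of a vertex set the ability to host every graph
    on [d] vertices as an induced copy with edges in [e].  Either one colour
    class is robustly dense in [U], with a threshold [n ^ (-O(d))] adapted to
    [d], in which case the greedy embedding works, or [U] contains two large
    sets [X], [Y] with few edges of that colour in between.  If then both [X]
    and [Y] have capacity [d] in the other colour, together they have capacity
    [2 d] in that colour.  Starting from capacity [n] in both colours and
    halving the two requirements alternately, the thresholds multiply up to
    [n ^ (-O(n))] only.

    The resulting blocks are embedded vertex by vertex: inside a block the
    candidate sets shrink by the robust density, across blocks they are roughly
    halved by pseudo-randomness.  The proportion of wrong-coloured edges from a
    candidate [w] of an earlier block into a candidate set of a later one must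
    not grow; for a fixed [w] almost every choice of the embedded vertex
    halves both the set and the neighbourhood of [w] in it, so that it suffices
    to discard few candidates [w] at each step. *)

(** * Degree counting and jumbled relations *)

Section Counting.
Context {R : realFieldType} {T : finType}.
Implicit Types (e : rel T) (A B X Y Z : {set T}).

Definition cardR (A : {set T}) : R := #|A|%:R.
Definition nbhd (e : rel T) x (Y : {set T}) : {set T} := [set y in Y | e x y].
Definition deg (e : rel T) x (Y : {set T}) : R := cardR (nbhd e x Y).

Lemma card_ge0 A : 0 <= cardR A. Proof. exact: ler0n. Qed.

Lemma card_subset A B : A \subset B -> cardR A <= cardR B.
Proof. by move=> AB; rewrite ler_nat; apply: subset_leq_card. Qed.

Lemma card_le_diff A B : cardR A - cardR B <= cardR (A :\: B).
Proof.
rewrite lerBlDr -natrD ler_nat -(cardsID B A) addnC leq_add2l.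
by apply/subset_leq_card/subsetIr.
Qed.

Lemma sum_const_card A (a : R) : \sum_(x in A) a = a * cardR A.
Proof. by rewrite sumr_const mulr_natr. Qed.

Lemma card_sum1 A : cardR A = \sum_(x in A) 1.
Proof. by rewrite sum_const_card mul1r. Qed.

Lemma deg_sum e x Y : deg e x Y = \sum_(y in Y) (e x y)%:R.
Proof.
rewrite /deg card_sum1 big_mkcond [RHS]big_mkcond; apply: eq_bigr => y _.
by rewrite inE; case: (y \in Y); case: (e x y).
Qed.

Lemma deg_double_count e e' A B : (forall x y, e x y = e' y x) ->
  \sum_(x in A) deg e x B = \sum_(y in B) deg e' y A.
Proof.
move=> ee'; under eq_bigr do rewrite deg_sum.
by rewrite exchange_big; apply: eq_bigr => y _; 
  rewrite deg_sum; apply: eq_bigr => x _; rewrite ee'.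
Qed.

Lemma markov A (f : T -> R) (a : R) : (forall x, x \in A -> 0 <= f x) ->
  a * cardR [set x in A | a < f x] <= \sum_(x in A) f x.
Proof.
move=> f0; rewrite -sum_const_card [leRHS](bigID (fun x => a < f x)) /=.
rewrite -[leLHS]addr0; apply: lerD; last by apply: sumr_ge0 => x /andP[/f0].
under eq_bigl do rewrite inE.
by apply: ler_sum => x /andP[_ /ltW].
Qed.

Lemma card_bigcup (I : finType) (P : pred I) (B : I -> {set T}) (b : R) :
  0 <= b -> (forall i, P i -> cardR (B i) <= b) ->
  cardR (\bigcup_(i | P i) B i) <= #|I|%:R * b.
Proof.
move=> b0 Bb; apply: (@le_trans _ _ (\sum_(i | P i) cardR (B i))).
  rewrite /cardR -natr_sum ler_nat; elim/big_rec2: _ => [|i m A Pi IH].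
    by rewrite cards0.
  by rewrite (leq_trans (leq_card_setU _ _))// leq_add2l.
apply: (@le_trans _ _ (\sum_(i | P i) b)); first exact: ler_sum.
by rewrite sumr_const mulr_natl; apply: ler_wpMn2l => //; apply: max_card.
Qed.

Lemma exists_avoiding (I : finType) (P : pred I) (B : I -> {set T}) A (b : R) :
  0 <= b -> (forall i, P i -> cardR (B i) <= b) -> #|I|%:R * b < cardR A ->
  exists2 x, x \in A & forall i, P i -> x \notin B i.
Proof.
move=> b0 Bb ltA; have /card_gt0P[x] : (0 < #|A :\: \bigcup_(i | P i) B i|)%N.
  rewrite -(@ltr0n R); apply: lt_le_trans (card_le_diff _ _).
  by rewrite subr_gt0; apply: le_lt_trans ltA; apply: card_bigcup.
rewrite inE => /andP[xB xA]; exists x => // i Pi.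
by apply: contra xB => xBi; apply/bigcupP; exists i.
Qed.

(** Double counting followed by Markov's inequality; the factor [cardR X] stays on both sides so
    that [X] may be empty. *)
Lemma card_many_bad_pairs (W : rel T) A X (a b : R) :
  (forall w, w \in X -> deg (fun w v => W v w) w A <= b) ->
  a * cardR X * cardR [set v in A | a * cardR X < deg W v X] <= b * cardR X.
Proof.
move=> Wb; apply: le_trans (_ : \sum_(v in A) deg W v X <= _).
  by apply: markov => v _; apply: card_ge0.
rewrite (@deg_double_count _ (fun w v => W v w))// -sum_const_card.
exact: ler_sum.
Qed.

(* The two relations "adjacent" and "distinct and non-adjacent" of a
   [(1/2, lambda)]-pseudo-random graph are both jumbled. *)
Definition jumbled (L : R) e := forall A B,
  (\sum_(x in A) deg e x B - cardR A * cardR B / 2) ^+ 2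
    <= L ^+ 2 * (cardR A * cardR B).

(** The squared total deviation is quadratic in [cardR S], its jumbledness bound only linear.
    Deviation is measured against [b] instead of [cardR X] because [X] will also be a neighbourhood,
    possibly much smaller than the candidate set around it. *)
Lemma jumbled_deviation (L : R) e X S (b g : R) : jumbled L e ->
  0 < g -> 0 < b -> cardR X <= b ->
  g * b * cardR S <= `|\sum_(x in S) deg e x X - cardR S * cardR X / 2| ->
  g ^+ 2 * b * cardR S <= L ^+ 2.
Proof.
move=> Le g0 b0 Xb dev; have := Le S X; have := card_ge0 S.
rewrite le_eqVlt => /predU1P[<- _|S0 Lsq]; first by rewrite mulr0 sqr_ge0.
have : (g * b * cardR S) ^+ 2 <= L ^+ 2 * (cardR S * b).
  apply: le_trans (_ : L ^+ 2 * (cardR S * cardR X) <= _); last first.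
    by rewrite ler_wpM2l ?sqr_ge0// ler_wpM2l// ltW.
  apply: le_trans Lsq; rewrite -[leRHS]real_normK ?num_real//.
  by rewrite lerXn2r ?nnegrE// !mulr_ge0// ?ltW.
have -> : (g * b * cardR S) ^+ 2 = g ^+ 2 * b * cardR S * (cardR S * b) by ring.
by rewrite ler_pM2r// mulr_gt0.
Qed.

Lemma jumbled_few_large (L : R) e X (b g : R) : jumbled L e ->
  0 < g -> 0 < b -> cardR X <= b ->
  g ^+ 2 * b * cardR [set v | cardR X / 2 + g * b < deg e v X] <= L ^+ 2.
Proof.
move=> Le g0 b0 Xb; apply: (jumbled_deviation Le g0 b0 Xb).
apply: le_trans (ler_norm _); set S := [set v | _].
have : \sum_(x in S) (cardR X / 2 + g * b) <= \sum_(x in S) deg e x X.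
  by apply: ler_sum => x; rewrite inE => /ltW.
rewrite sum_const_card; lra.
Qed.

Lemma jumbled_few_small (L : R) e X (b g : R) : jumbled L e ->
  0 < g -> 0 < b -> cardR X <= b ->
  g ^+ 2 * b * cardR [set v | deg e v X < cardR X / 2 - g * b] <= L ^+ 2.
Proof.
move=> Le g0 b0 Xb; apply: (jumbled_deviation Le g0 b0 Xb).
rewrite distrC; apply: le_trans (ler_norm _); set S := [set v | _].
have : \sum_(x in S) deg e x X <= \sum_(x in S) (cardR X / 2 - g * b).
  by apply: ler_sum => x; rewrite inE => /ltW.
rewrite sum_const_card; lra.
Qed.

End Counting.

(** * Finding blocks for one of two colours *)

Section Blocks.
Context {R : realFieldType} {T : finType}.
Local Notation vol := (@cardR R T).
Local Notation deg := (@deg R T).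
Variables (n : nat) (mu : R).
Hypotheses (n_gt0 : (0 < n)%N) (mu_gt0 : 0 < mu).
Implicit Types (e : rel T) (U X Y : {set T}).

(** Fitted to the cleaning in [has_blocks_double], where the factors 4, [32 * n] and [2 * n] meet;
    it also exceeds the number [n + n ^ 2] of exceptional sets in an embedding step. *)
Definition scale : R := 256 * n%:R ^+ 2.

(* A candidate set loses at most a factor 3 per vertex embedded in an earlier
   block and at most a factor [scale] per vertex embedded in its own block. *)
Definition shrink (d : nat) : R := 3 ^+ n * scale ^+ d.+1.

(** Density at least [2 / scale] between non-negligible subsets; half of it is left after spoiled
    candidates are removed. *)
Definition robustly_dense (d : nat) e U : bool :=
  [forall X : {set T}, forall Y : {set T},
    [&& X \subset U, Y \subset U, vol U <= shrink d * vol X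
      & vol U <= shrink d * vol Y] ==>
    (2 * vol X * vol Y <= scale * \sum_(x in X) deg e x Y)].

(* Block [l] hosts the [l]-th vertex; the indices sharing the block of [l] are
   those of the interval starting at [p l], of length at most [c l]. *)
Record block_system e e' (d : nat) U (V : nat -> {set T}) (p c : nat -> nat) :
    Prop := BlockSystem {
  block_sub : forall l, (l < d)%N -> V l \subset U;
  block_large : forall l, (l < d)%N -> mu <= vol (V l);
  block_itv : forall l, (l < d)%N -> (p l <= l < p l + c l)%N;
  block_sparse : forall i l, (i < p l)%N -> (l < d)%N -> forall w, w \in V i ->
    32 * n%:R * deg e' w (V l) <= vol (V l);
  block_dense : forall i l, (p l <= i < l)%N -> (l < d)%N ->
    [/\ V i = V l, p i = p l, c i = c l & robustly_dense (c l) e (V l)] }.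

Definition has_blocks e e' d U := exists V p c, block_system e e' d U V p c.

Lemma scale_gt0 : 0 < scale.
Proof. by rewrite mulr_gt0 ?exprn_gt0 ?ltr0n. Qed.

Lemma scale_ge1 : 1 <= scale.
Proof.
have : 1 <= n%:R :> R by rewrite ler1n.
rewrite /scale; nra.
Qed.

Lemma shrink_gt0 d : 0 < shrink d.
Proof. by rewrite mulr_gt0 ?exprn_gt0 ?scale_gt0. Qed.

Lemma shrink_ge1 d : 1 <= shrink d.
Proof. by rewrite mulr_ege1 // ?exprn_ege1 ?scale_ge1 ?ler1n. Qed.

Lemma has_blocks_sub e e' d U U' :
  U' \subset U -> has_blocks e e' d U' -> has_blocks e e' d U.
Proof.
move=> sU [V [p [c [h1 h2 h3 h4 h5]]]]; exists V, p, c; split=> // l ld.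
exact: subset_trans (h1 l ld) sU.
Qed.

Lemma has_blocks_dense e e' d U :
  mu <= vol U -> robustly_dense d e U -> has_blocks e e' d U.
Proof.
move=> muU dU; exists (fun=> U), (fun=> 0%N), (fun=> d).
by split=> // l; rewrite add0n.
Qed.

Lemma has_blocks1 e e' U : mu <= vol U -> has_blocks e e' 1 U.
Proof.
move=> muU; exists (fun=> U), (fun=> 0%N), (fun=> 1%N).
by split=> // i [|l]; rewrite ?ltn0 ?andbF.
Qed.

Lemma has_blocks_cat e e' d1 d2 U1 U2 U V1 p1 c1 V2 p2 c2 :
  U1 \subset U -> U2 \subset U ->
  block_system e e' d1 U1 V1 p1 c1 -> block_system e e' d2 U2 V2 p2 c2 ->
  (forall w l, w \in U1 -> (l < d2)%N ->
     32 * n%:R * deg e' w (V2 l) <= vol (V2 l)) ->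
  has_blocks e e' (d1 + d2) U.
Proof.
move=> sU1 sU2 [sub1 lar1 itv1 spa1 den1] [sub2 lar2 itv2 spa2 den2] cross.
exists (fun l => if (l < d1)%N then V1 l else V2 (l - d1)%N),
  (fun l => if (l < d1)%N then p1 l else (d1 + p2 (l - d1))%N),
  (fun l => if (l < d1)%N then c1 l else c2 (l - d1)%N).
have lt2 l : (l < d1)%N = false -> (l < d1 + d2)%N -> (l - d1 < d2)%N by lia.
split.
- move=> l ld; case: ifP => [l1|/lt2/(_ ld) l2].
    by apply: subset_trans sU1; apply: sub1.
  by apply: subset_trans sU2; apply: sub2.
- by move=> l ld; case: ifP => [/lar1//|/lt2/(_ ld)/lar2].
- move=> l ld; case: ifP => [/itv1//|l1]; have := itv2 _ (lt2 _ l1 ld); lia.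
- move=> i l + ld w; case: (ltnP l d1) => [l1 ip|l1].
    have := itv1 _ l1 => itv; have -> : (i < d1)%N by lia.
    exact: spa1.
  have l2 : (l - d1 < d2)%N by lia.
  case: (ltnP i d1) => [i1 _ wi|i1 ip wi]; last first.
    by apply: (spa2 (i - d1)%N) => //; lia.
  by apply: cross => //; apply: (subsetP (sub1 _ i1)).
- move=> i l + ld; case: (ltnP l d1) => [l1 ip|l1 ip].
    have -> : (i < d1)%N by lia.
    exact: den1.
  have -> : (i < d1)%N = false by lia.
  have [||-> -> -> ->] := den2 (i - d1)%N (l - d1)%N; [lia|lia|by []].
Qed.

(** Failure of robust density yields a sparse pair [X], [Y]. First [Y] is cleaned: a degree bound at
    every vertex of [Y'] passes to any blocks chosen inside. Then [X] is cleaned against these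
    actual blocks, and its own blocks are placed before them. [Z] passes any other outcome through
    unchanged. *)
Lemma has_blocks_double e e' d d' U (Z : Prop) :
  symmetric e' -> (0 < d <= n)%N ->
  (forall U', U' \subset U -> vol U <= 2 * shrink d' * vol U' ->
     has_blocks e e' d U' \/ Z) ->
  ~~ robustly_dense d' e' U -> has_blocks e e' (d + d) U \/ Z.
Proof.
move=> sym_e' /andP[d0 dn] IH /forallPn[X /forallPn[Y]].
rewrite negb_imply -ltNge => /andP[/and4P[XU YU UX UY] sparse].
have D0 := shrink_gt0 d'; have M0 := scale_gt0.
have U2 (A B : {set T}) : vol U <= shrink d' * vol A ->
    vol A <= 2 * vol B -> vol U <= 2 * shrink d' * vol B :> R.
  move=> h1 h2; apply: le_trans h1 _.
  by rewrite (mulrC 2) -(mulrA (shrink d')) ler_pM2l.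
have [nX0|X0] := eqVneq X set0.
  by move: sparse; rewrite nX0 /vol cards0 big_set0 !mulr0 mul0r ltxx.
have [nY0|Y0] := eqVneq Y set0.
  have : 0 <= \sum_(x in X) deg e' x Y.
    by apply: sumr_ge0 => x _; apply: card_ge0.
  move: sparse; rewrite {2}nY0 {2}/vol cards0; nra.
have cX0 : 0 < vol X by rewrite ltr0n card_gt0.
have cY0 : 0 < vol Y by rewrite ltr0n card_gt0.
(* The average degree into [X] is below [2 * vol X / scale]; at most half of [Y] exceeds twice
   that. *)
pose bad := [set y in Y | 4 * vol X / scale < deg e' y X].
have bad_small : 2 * vol bad <= vol Y.
  have := @markov R _ Y (fun y => deg e' y X) (4 * vol X / scale)
     (fun y _ => card_ge0 _).
  rewrite -(deg_double_count X Y sym_e') -/bad => mk.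
  suff : 4 * vol X * vol bad < 2 * vol X * vol Y.
    by move=> ?; rewrite -(ler_pM2l cX0); lra.
  apply: le_lt_trans sparse; rewrite -ler_pdivrMl// mulrC; apply: le_trans mk.
  by rewrite mulrAC.
pose Y' := Y :\: bad.
have Y'Y : vol Y <= 2 * vol Y'.
  have := @card_le_diff R _ Y bad; rewrite -/Y'; lra.
have Y'deg y : y \in Y' -> deg e' y X <= 4 * vol X / scale.
  by rewrite !inE negb_and => /andP[/orP[/negP//|]]; rewrite -leNgt.
have sY' : Y' \subset Y by apply: subsetDl.
case: (IH Y') => [| |[V2 [p2 [c2 bs2]]]|]; [|exact: U2 UY Y'Y| |by right].
  exact: subset_trans sY' YU.
(* Each block excludes at most a share [1 / (2 * n)] of [X], so that [d <= n] blocks leave half of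
   it. *)
pose badX (j : 'I_d) :=
  [set x in X | vol (V2 j) / (32 * n%:R) < deg e' x (V2 j)].
have n0 : 0 < n%:R :> R by rewrite ltr0n.
have badXle j : vol (badX j) <= vol X / (2 * n%:R).
  have V0 := lt_le_trans mu_gt0 (block_large bs2 (ltn_ord j)).
  have := @markov R _ X (fun x => deg e' x (V2 j)) (vol (V2 j) / (32 * n%:R))
    (fun y _ => card_ge0 _).
  rewrite /= (deg_double_count X _ sym_e') -/(badX j) => mk.
  have : \sum_(y in V2 j) deg e' y X <= 4 * vol X / scale * vol (V2 j).
    rewrite -sum_const_card; apply: ler_sum => y yV; apply: Y'deg.
    exact: (subsetP (block_sub bs2 (ltn_ord j))).
  move=> /(le_trans mk) le1; rewrite -(ler_pM2l V0).
  have nn0 := lt0r_neq0 n0; have n32 : 0 < 32 * n%:R :> R by rewrite mulr_gt0.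
  have -> : vol (V2 j) * vol (badX j)
      = 32 * n%:R * (vol (V2 j) / (32 * n%:R) * vol (badX j)) by field.
  have -> : vol (V2 j) * (vol X / (2 * n%:R))
      = 32 * n%:R * (4 * vol X / scale * vol (V2 j)) by rewrite /scale; field.
  by rewrite ler_pM2l.
pose X' := X :\: \bigcup_j badX j.
have X'X : vol X <= 2 * vol X'.
  have := @card_le_diff R _ X (\bigcup_j badX j); rewrite -/X'.
  have := @card_bigcup R _ _ xpredT badX (vol X / (2 * n%:R)).
  have bpos : 0 <= vol X / (2 * n%:R) by rewrite divr_ge0// mulr_ge0// ltW.
  move=> /(_ bpos (fun i _ => badXle i)); rewrite card_ord => cb.
  have : d%:R * (vol X / (2 * n%:R)) <= n%:R * (vol X / (2 * n%:R)).
    by rewrite ler_wpM2r// ler_nat.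
  have -> : n%:R * (vol X / (2 * n%:R)) = vol X / 2.
    by field; rewrite gt_eqF.
  lra.
have sX' : X' \subset X by apply: subsetDl.
have X'U := subset_trans sX' XU.
case: (IH X') => [//| |[V1 [p1 [c1 bs1]]]|]; [exact: U2 UX X'X| |by right].
left; apply: (has_blocks_cat X'U (subset_trans sY' YU) bs1 bs2) => w l.
rewrite inE => /andP[+ wX] ld; apply: contraR; rewrite -ltNge => lt.
apply/bigcupP; exists (Ordinal ld) => //; rewrite inE wX/=.
by rewrite ltr_pdivrMr ?mulr_gt0// mulrC.
Qed.

(** One round pays for a failure of robust density in each colour, and a factor 2 for each
    cleaning. *)
Fixpoint ramsey_size (h : nat) : R :=
  if h is h'.+1 then
    2 * shrink (2 ^ h'.+1) * (2 * shrink (2 ^ h') * ramsey_size h')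
  else mu.

Lemma ramsey_size_ge h : mu <= ramsey_size h.
Proof.
elim: h => //= h IH; have := shrink_ge1 (2 ^ h.+1); have := shrink_ge1 (2 ^ h).
move: IH mu_gt0; set s := ramsey_size h; set a := shrink _; set b := shrink _.
move=> ms m0 b1 a1; apply: (le_trans ms).
have a2 : 1 <= 2 * a by lra.
have b2 : 1 <= 2 * b by lra.
by rewrite mulrA ler_peMl ?(mulr_ege1 b2 a2)//; lra.
Qed.

(* Alternating between the two colours makes the two density thresholds drop
   geometrically, so that only the sum of the capacities enters the bound. *)
Lemma ramsey_blocks e e' h U : symmetric e -> symmetric e' -> (2 ^ h <= n)%N ->
  ramsey_size h <= vol U ->
  has_blocks e e' (2 ^ h) U \/ has_blocks e' e (2 ^ h) U.
Proof.
move=> se se'; elim: h U => [|h IH] U hn szU.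
  by left; apply: has_blocks1.
have hn' : (0 < 2 ^ h <= n)%N.
  by rewrite expn_gt0 (leq_trans _ hn)// leq_exp2l.
have szU' := le_trans (ramsey_size_ge _) szU.
have [dU|ndU] := boolP (robustly_dense (2 ^ h.+1) e U).
  by left; apply: has_blocks_dense.
(* Inside [U1] it is enough to find [2 ^ h] blocks for [e'], to be doubled, or at once [2 ^ h.+1]
   blocks for [e], which a second failure, now of [e'], provides by doubling. *)
suff : has_blocks e' e (2 ^ h + 2 ^ h) U \/ has_blocks e e' (2 ^ h.+1) U.
  by rewrite addnn -mul2n -expnS => -[]; [right|left].
apply: has_blocks_double ndU => // U1 sU1 szU1.
have sz1 : 2 * shrink (2 ^ h) * ramsey_size h <= vol U1.
  have := le_trans szU szU1; rewrite /= ler_pM2l//.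
  by rewrite mulr_gt0 ?shrink_gt0.
have [dU1|ndU1] := boolP (robustly_dense (2 ^ h) e' U1).
  left; apply: has_blocks_dense => //; apply: le_trans sz1.
  apply: le_trans (ramsey_size_ge h) _; rewrite ler_peMl//.
    exact: le_trans (ltW mu_gt0) (ramsey_size_ge h).
  have := shrink_ge1 (2 ^ h); lra.
suff : has_blocks e e' (2 ^ h + 2 ^ h) U1 \/ has_blocks e' e (2 ^ h) U1.
  by rewrite addnn -mul2n -expnS => -[/(has_blocks_sub sU1)|]; [right|left].
apply: has_blocks_double ndU1 => // U2 sU2 szU2.
have szU2' : ramsey_size h <= vol U2.
  have := le_trans sz1 szU2; rewrite ler_pM2l//.
  by rewrite mulr_gt0 ?shrink_gt0.
have [|/(has_blocks_sub sU2)] := IH U2 (proj2 (andP hn')) szU2'; first by left.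
by right.
Qed.

End Blocks.

(** * Embedding vertex by vertex along a block system *)

Lemma loss_small {R : realFieldType} (N q : R)
  (loss := 2 / (256 * N ^+ 2) + q / (32 * N ^+ 2)) :
  1 <= N -> 0 <= q -> q + 1 <= 2 * N ->
  loss <= 1 / 6 /\ (q + 1) * loss <= 9 / 64.
Proof.
move=> N1 q0 qN; have N0 : 0 < N by lra.
have -> : loss = (1 / 4 + q) / (32 * N ^+ 2).
  by rewrite /loss; field; rewrite gt_eqF.
have N2 : 0 < 32 * N ^+ 2 by rewrite mulr_gt0// exprn_gt0.
have q2 : (q + 1) * (q + 1) <= (2 * N) * (2 * N) by rewrite ler_pM//; lra.
clear loss; split; [rewrite ler_pdivrMr//|rewrite mulrA ler_pdivrMr//]; nra.
Qed.

Section Embedding.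
Context {R : realFieldType} {T : finType}.
Local Notation vol := (@cardR R T).
Local Notation deg := (@deg R T).
(** In the application [E] is adjacency or non-adjacency, [F] moreover asks edges to have the wanted
    colour, and [bl] consists of the edges of the other colour. *)
Variables (n : nat) (mu L : R) (E F : bool -> rel T) (bl : rel T).
Local Notation s := (@scale R n).
Hypotheses (n_gt0 : (0 < n)%N) (mu_gt0 : 0 < mu) (L_ge0 : 0 <= L).
Hypothesis E_jumbled : forall a, jumbled L (E a).
Hypothesis L_small : L * s ^+ 3 * (3 ^+ n * s ^+ n) <= mu.
Hypothesis FE : forall a x y, F a x y -> E a x y.
Hypothesis EF : forall a x y, E a x y -> F a x y || bl x y.
Hypothesis EF0 : forall x y, E false x y -> F false x y.
Variables (U : {set T}) (V : nat -> {set T}) (p c : nat -> nat).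
Hypothesis bs : block_system n mu (F true) bl n U V p c.
Variable hadj : nat -> nat -> bool.

Record partial_embedding t (v : nat -> T) (X : nat -> {set T}) : Prop :=
  PartialEmbedding {
  pe_emb : forall i j, (i < j < t)%N -> F (hadj i j) (v i) (v j);
  pe_sub : forall l, (t <= l < n)%N -> X l \subset V l;
  pe_adj : forall i l y, (i < t)%N -> (t <= l < n)%N -> y \in X l ->
    F (hadj i l) (v i) y;
  pe_size : forall l, (t <= l < n)%N ->
    vol (V l) <= 3 ^+ t * s ^+ (t - p l) * vol (X l);
  pe_sparse : forall j l w, (t <= j < p l)%N -> (l < n)%N -> w \in X j ->
    32 * n%:R ^+ 2 * deg bl w (X l) <= (n + t)%:R * vol (X l) }.

Let N_ge1 : 1 <= n%:R :> R. Proof. by rewrite ler1n. Qed.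
Let s_gt0 : 0 < s. Proof. exact: scale_gt0. Qed.
Let s_ge256 : 256 <= s. Proof. rewrite /scale; have := N_ge1; nra. Qed.
Let s_ge_n : n%:R <= s. Proof. rewrite /scale; have := N_ge1; nra. Qed.

Lemma partial_embedding0 x0 : partial_embedding 0 (fun=> x0) V.
Proof.
have [_ _ _ sp _] := bs.
split=> //; first by move=> i j; rewrite ltn0 andbF.
- by move=> l _; rewrite sub0n !expr0 !mul1r.
- move=> j l w jl ln wV; rewrite addn0; have := sp _ _ jl ln _ wV.
  rewrite expr2 => /(ler_wpM2l (ler0n R n)); lra.
Qed.

Section Step.
Variables (t : nat) (v : nat -> T) (X : nat -> {set T}).
Hypotheses (t_lt_n : (t < n)%N) (pe : partial_embedding t v X).
Let adjT l := hadj t l.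

Let candidates_large l : (t <= l < n)%N -> L * s ^+ 3 <= vol (X l).
Proof.
move=> tl; have ln : (l < n)%N by case/andP: tl.
have K0 : 0 < 3 ^+ n * s ^+ n by rewrite mulr_gt0 ?exprn_gt0.
rewrite -(ler_pM2r K0); apply: le_trans L_small _.
apply: le_trans (block_large bs ln) _; apply: le_trans (pe_size pe tl) _.
rewrite mulrC ler_wpM2l ?card_ge0// ler_pM ?exprn_ge0 ?(ltW s_gt0)//.
  by rewrite ler_eXn2l ?ltr1n// ltnW.
by rewrite ler_weXn2l ?scale_ge1//; lia.
Qed.

Let candidates_gt0 l : (t <= l < n)%N -> 0 < vol (X l).
Proof.
move=> tl; have ln : (l < n)%N by case/andP: tl.
have := lt_le_trans mu_gt0 (block_large bs ln).
move=> /lt_le_trans/(_ (pe_size pe tl)); rewrite pmulr_rgt0//.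
by rewrite mulr_gt0 ?exprn_gt0.
Qed.

(** Jumbledness with deviation [1 / s] bounds an exceptional set by [L ^ 2 * s ^ 2 / x], which is at
    most [L / s] once [x >= L * s ^ 3]. *)
Let small_set (x b : R) : 0 < x -> L * s ^+ 3 <= x ->
  s^-1 ^+ 2 * x * b <= L ^+ 2 -> s * b <= L.
Proof.
move=> x0 Lx xb; have s2 : 0 < s ^+ 2 by rewrite exprn_gt0.
have {xb} xb : x * b <= L ^+ 2 * s ^+ 2.
  by rewrite -ler_pdivrMr// (le_trans _ xb)// exprVn -mulrA mulrC.
have [L0|L0|L0] := ltgtP L 0; first by move: L_ge0; lra.
  have [b0|b0] := leP b 0.
    by apply: le_trans (ltW L0); rewrite pmulr_rle0.
  have Ls : 0 < L * s ^+ 2 by rewrite mulr_gt0.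
  rewrite -(ler_pM2l Ls).
  have -> : L * s ^+ 2 * (s * b) = L * s ^+ 3 * b by ring.
  have -> : L * s ^+ 2 * L = L ^+ 2 * s ^+ 2 by ring.
  by apply: le_trans xb; rewrite ler_wpM2r// ltW.
by move: xb; rewrite L0 expr0n mul0r pmulr_rle0// => b0; rewrite pmulr_rle0.
Qed.

(** For a later block or a non-edge, jumbledness predicts about half of [X l]; for an edge inside a
    block there is only robust density. *)
Let bad_vertex l := [set x in X t |
  if (t < p l)%N || ~~ adjT l
  then deg (E (adjT l)) x (X l) < vol (X l) / 2 - s^-1 * vol (X l)
  else s * deg (F true) x (X l) < 2 * vol (X l)].

(* The pairs [(x, w)] for which choosing [x] concentrates [X l] on the
   [bl]-neighbourhood of [w]. *)
Let bad_pair l x w := let N := nbhd bl w (X l) in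
  vol N / 2 + s^-1 * vol (X l) < deg (E (adjT l)) x N.

(** With the share [1 / (n * s)], all [l] together spoil at most a share [1 / s] of [X j]. *)
Let bad_for_pair j l := [set x in X t |
  (n%:R * s)^-1 * vol (X j) < deg (bad_pair l) x (X j)].

(** Jumbledness settles the first case. In the second, a larger bad set and [X l] would be a sparse
    pair of large subsets of [V l], against robust density. *)
Let bad_vertex_small l : (t < l < n)%N -> s * vol (bad_vertex l) <= vol (X t).
Proof.
move=> /andP[tl ln]; have tn : (t <= t < n)%N by rewrite leqnn.
have ltn : (t <= l < n)%N by rewrite ltnW.
rewrite /bad_vertex; case: (boolP ((t < p l)%N || ~~ adjT l)) => [_|].
  set B := [set x in _ | _].
  have : s * vol B <= L.
    apply: (small_set (candidates_gt0 ltn) (candidates_large ltn)).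
    have := jumbled_few_small (E_jumbled (adjT l)) _ (candidates_gt0 ltn)
      (lexx _).
    move=> /(_ s^-1); rewrite invr_gt0 => /(_ s_gt0); apply: le_trans.
    rewrite ler_wpM2l ?mulr_ge0 ?exprn_ge0 ?invr_ge0 ?card_ge0 ?(ltW s_gt0)//.
    by apply: card_subset; apply/subsetP => x; rewrite !inE => /andP[].
  move=> /le_trans; apply; apply: le_trans (candidates_large tn).
  by rewrite ler_peMr// exprn_ege1// scale_ge1.
rewrite negb_or negbK -leqNgt => /andP[pt _].
set B := [set x in _ | _]; rewrite leNgt; apply/negP => lt.
have [|eV ep ec dV] := block_dense bs (i := t) (l := l) _ ln.
  by rewrite pt.
have lt_c : (t - p l < c l)%N by move: (block_itv bs ln) pt tl; clear; lia.
(* The exponent stays within [c l]; the additional factor [scale] in [shrink] pays for passing from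
   [X t] to [B]. *)
have shr (y z : R) : y <= 3 ^+ t * s ^+ (t - p l) * z -> 0 <= z ->
    y <= 3 ^+ n * s ^+ (c l) * z.
  move=> /le_trans yz z0; apply: yz; rewrite ler_wpM2r//.
  rewrite ler_pM ?exprn_ge0 ?(ltW s_gt0)//.
    by rewrite ler_eXn2l ?ltr1n// ltnW.
  by rewrite ler_weXn2l ?scale_ge1// ltnW.
move/forallP/(_ B)/forallP/(_ (X l))/implyP: dV.
have sB : B \subset V l.
  rewrite -eV; apply: subset_trans (pe_sub pe tn).
  by apply/subsetP => x; rewrite inE => /andP[].
rewrite sB (pe_sub pe ltn) /shrink exprSr.
have -> : vol (V l) <= 3 ^+ n * (s ^+ c l * s) * vol B.
  have := pe_size pe tn; rewrite eV ep => /shr/(_ (card_ge0 _)).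
  move=> /le_trans; apply; rewrite (mulrA _ _ s) -(mulrA _ s).
  rewrite ler_wpM2l ?(ltW lt)//.
  by rewrite mulr_ge0 ?exprn_ge0 ?(ltW s_gt0).
have -> : vol (V l) <= 3 ^+ n * (s ^+ c l * s) * vol (X l).
  have := shr _ _ (pe_size pe ltn) (card_ge0 _).
  move=> /le_trans; apply; rewrite mulrA ler_wpM2r ?card_ge0//.
  by rewrite ler_peMr ?scale_ge1// mulr_ge0 ?exprn_ge0 ?(ltW s_gt0).
move=> /(_ isT); apply/negP; rewrite -ltNge mulr_sumr.
have -> : 2 * vol B * vol (X l) = \sum_(x in B) (2 * vol (X l)).
  by rewrite sum_const_card; ring.
have B0 : (0 < #|B|)%N.
  rewrite -(@ltr0n R) -(pmulr_rgt0 _ s_gt0).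
  exact: lt_trans (candidates_gt0 tn) lt.
apply: ltr_sum => [|x]; last by rewrite inE => /andP[].
by case/card_gt0P: B0 => x xB; apply/hasP; exists x.
Qed.

(** Jumbledness, applied to the [bl]-neighbourhood of a fixed [w], leaves few bad [x]; by double
    counting, few [x] are bad for many [w]. *)
Let bad_for_pair_small j l : (t < j < n)%N -> (t < l < n)%N ->
  s * vol (bad_for_pair j l) <= vol (X t).
Proof.
move=> /andP[tj jn] /andP[tl ln].
have tn : (t <= t < n)%N by rewrite leqnn.
have ltn : (t <= l < n)%N by rewrite ltnW.
have jtn : (t <= j < n)%N by rewrite ltnW.
have bad_w w : w \in X j -> deg (fun w x => bad_pair l x w) w (X t) <= s^-1 * L.
  move=> _; rewrite ler_pdivlMl//.
  apply: (small_set (candidates_gt0 ltn) (candidates_large ltn)).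
  have sN : vol (nbhd bl w (X l)) <= vol (X l).
    by apply: card_subset; apply/subsetP => y; rewrite inE => /andP[].
  have := jumbled_few_large (E_jumbled (adjT l)) _ (candidates_gt0 ltn) sN.
  move=> /(_ s^-1); rewrite invr_gt0 => /(_ s_gt0); apply: le_trans.
  rewrite ler_wpM2l ?mulr_ge0 ?exprn_ge0 ?invr_ge0 ?card_ge0 ?(ltW s_gt0)//.
  by apply: card_subset; apply/subsetP => x; rewrite !inE => /andP[].
have := card_many_bad_pairs (n%:R * s)^-1 bad_w; rewrite -/(bad_for_pair j l).
have n0 : 0 < n%:R :> R by rewrite ltr0n.
rewrite mulrAC ler_pM2r ?candidates_gt0// ler_pdivrMl ?mulr_gt0//.
have -> : n%:R * s * (s^-1 * L) = n%:R * L by field; rewrite gt_eqF.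
rewrite -(ler_pM2l s_gt0) => /le_trans; apply.
apply: le_trans (candidates_large tn).
have : s * n%:R <= s * s * s.
  apply: le_trans (_ : s * s <= _); first by rewrite ler_pM2l.
  by rewrite ler_peMr ?scale_ge1// mulr_ge0// ltW.
move=> /(ler_wpM2l L_ge0); rewrite !exprS expr0; lra.
Qed.

(** Union bound over at most [n + n ^ 2] exceptional sets, each at most a share [1 / s] of [X t]. *)
Lemma exists_good_vertex : exists2 x, x \in X t &
  (forall l, (t < l < n)%N -> x \notin bad_vertex l) /\
  (forall j l, (t < j < n)%N -> (t < l < n)%N -> x \notin bad_for_pair j l).
Proof.
have tn : (t <= t < n)%N by rewrite leqnn.
pose P (i : 'I_n + 'I_n * 'I_n) := match i with
  | inl l => (t < l)%N | inr (j, l) => (t < j)%N && (t < l)%N end.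
pose B (i : 'I_n + 'I_n * 'I_n) := match i with
  | inl l => bad_vertex l | inr (j, l) => bad_for_pair j l end.
have [| | |x xX xB] := @exists_avoiding R _ _ P B (X t) (s^-1 * vol (X t)).
- by rewrite mulr_ge0 ?invr_ge0 ?card_ge0// ltW.
- move=> [l /= tl|[j l] /andP[tj tl]]; rewrite ler_pdivlMl//.
    by apply: bad_vertex_small; rewrite tl ltn_ord.
  by apply: bad_for_pair_small; rewrite ?tj ?tl ltn_ord.
- rewrite card_sum card_prod card_ord mulrA gtr_pMl ?candidates_gt0//.
  rewrite ltr_pdivrMr// mul1r natrD natrM /scale; have := N_ge1; nra.
exists x => //; split=> [l /andP[tl ln]|j l /andP[tj jn] /andP[tl ln]].
  exact: (xB (inl (Ordinal ln)) tl).
by apply: (xB (inr (Ordinal jn, Ordinal ln))); rewrite /= tj.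
Qed.

(** Shortfall from one half in a later block, with [q = n + t]: [1 / s] from jumbledness, [1 / s]
    from spoiled candidates, the rest from [bl]-edges at the new vertex. *)
Let loss (q : R) := 2 / s + q / (32 * n%:R ^+ 2).

Lemma partial_embedding_step : exists v' X', partial_embedding t.+1 v' X'.
Proof.
have [x xXt [good1 good2]] := exists_good_vertex.
have tn : (t <= t < n)%N by rewrite leqnn.
(* Candidates [w] forming a bad pair with [x] for some [l] are dropped, as their sparsity towards
   [X l] might be lost. *)
pose spoiled j := \bigcup_(l < n | (t < l)%N) nbhd (bad_pair l) x (X j).
pose X' j := nbhd (F (adjT j)) x (X j) :\: spoiled j.
pose v' i := if i == t then x else v i.
have s0 := s_gt0; have N1 := N_ge1.
have n0 : 0 < n%:R :> R by rewrite ltr0n.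
have X'sub j : X' j \subset X j.
  by apply/subsetP => y; rewrite !inE => /andP[_ /andP[]].
have spoiled_small j : (t < j < n)%N -> vol (spoiled j) <= vol (X j) / s.
  move=> tj.
  apply: le_trans (_ : #|'I_n|%:R * ((n%:R * s)^-1 * vol (X j)) <= _).
    apply: card_bigcup => [|l tl].
      by rewrite mulr_ge0 ?invr_ge0 ?card_ge0 ?mulr_ge0// ltW.
    have := good2 j l tj; rewrite tl ltn_ord => /(_ isT).
    by rewrite inE xXt -leNgt.
  rewrite card_ord le_eqVlt; apply/orP; left; apply/eqP; field.
  by rewrite !gt_eqF.
have X'large j : (t < j < n)%N ->
    deg (F (adjT j)) x (X j) - vol (X j) / s <= vol (X' j).
  move=> /spoiled_small sp.
  have := @card_le_diff R _ (nbhd (F (adjT j)) x (X j)) (spoiled j).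
  rewrite -/(X' j); move: sp; rewrite /deg; lra.
have q_ge0 : 0 <= (n + t)%:R :> R by [].
have q_le : (n + t)%:R + 1 <= 2 * n%:R :> R.
  by rewrite natr1 -natrM ler_nat; move: t_lt_n; clear; lia.
(* The bound 1/6 keeps a third of the candidates; 9/64 allows the numerator [n + t] of the sparsity
   bound to grow by only 1. *)
have [loss6 loss64] := loss_small N1 q_ge0 q_le.
have X'far j : (t < p j)%N -> (t < j < n)%N ->
    (1 / 2 - loss (n + t)%:R) * vol (X j) <= vol (X' j).
  move=> tp tj; apply: le_trans (X'large _ tj); have /andP[_ jn] := tj.
  have := good1 _ tj; rewrite inE xXt tp /= -leNgt => Elarge.
  have := @pe_sparse _ _ _ pe t j x; rewrite leqnn tp => /(_ isT jn xXt) sparse.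
  have EFbl : deg (E (adjT j)) x (X j)
      <= deg (F (adjT j)) x (X j) + deg bl x (X j).
    rewrite -natrD ler_nat; apply: leq_trans (leq_card_setU _ _).
    apply/subset_leq_card/subsetP => y; rewrite !inE => /andP[-> /EF].
    by case/orP => ->; rewrite ?orbT.
  have N2 : 0 < 32 * n%:R ^+ 2 :> R by rewrite mulr_gt0// exprn_gt0.
  have : deg bl x (X j) <= (n + t)%:R / (32 * n%:R ^+ 2) * vol (X j).
    by rewrite mulrAC ler_pdivlMr// mulrC.
  move: Elarge EFbl; rewrite /loss; lra.
(* An edge keeps a share [2 / s] by robust density, a non-edge nearly one half; spoiled candidates
   take [1 / s]. *)
have X'near j : (p j <= t)%N -> (t < j < n)%N -> vol (X j) / s <= vol (X' j).
  move=> tp tj; apply: le_trans (X'large _ tj).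
  have tj' : (t <= j < n)%N by case/andP: tj => /ltnW -> ->.
  suff : 2 * (vol (X j) / s) <= deg (F (adjT j)) x (X j) by lra.
  have := good1 _ tj; rewrite inE xXt ltnNge tp /=; case: (adjT j) => /=.
    by rewrite -leNgt mulrA ler_pdivrMr// [_ * s]mulrC.
  rewrite -leNgt => Elarge.
  have EF' : deg (E false) x (X j) <= deg (F false) x (X j).
    by apply: card_subset; apply/subsetP => y; rewrite !inE => /andP[-> /EF0].
  have : vol (X j) / s <= vol (X j) / 8.
    rewrite ler_wpM2l ?card_ge0// lef_pV2 ?posrE//.
    by apply: le_trans s_ge256; rewrite ler_nat.
  have := candidates_gt0 tj'; move: Elarge EF'; lra.
have tl_n l : (t.+1 <= l < n)%N -> (t <= l < n)%N by case/andP => /ltnW -> ->.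
exists v', X'; split.
- move=> i j /andP[+ jt]; move: jt; rewrite ltnS leq_eqVlt /v'.
  move=> /predU1P[-> it|jt ij].
    by rewrite eqxx (ltn_eqF it); apply: (pe_adj pe).
  rewrite (ltn_eqF jt) (ltn_eqF (ltn_trans ij jt)).
  by apply: (pe_emb pe); rewrite ij.
- by move=> l /tl_n tl; apply: subset_trans (X'sub l) (pe_sub pe tl).
- move=> i l y; rewrite ltnS leq_eqVlt /v' => /predU1P[->|it] tl yX'.
    by rewrite eqxx; move: yX'; rewrite !inE => /andP[_ /andP[]].
  rewrite ltn_eqF//; apply: (pe_adj pe) => //; first exact: tl_n.
  exact: (subsetP (X'sub l)).
- move=> l tl; apply: le_trans (pe_size pe (tl_n _ tl)) _.
  have := candidates_gt0 (tl_n _ tl) => X0.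
  case: (leqP (p l) t) => pt.
    have := X'near l pt tl; rewrite subSn// ler_pdivrMr// => X's.
    rewrite exprS [s ^+ _.+1]exprSr.
    apply: le_trans (_ : 3 ^+ t * s ^+ (t - p l) * (vol (X' l) * s) <= _).
      by rewrite ler_wpM2l// mulr_ge0 ?exprn_ge0// ltW.
    have : 0 <= 3 ^+ t * (s ^+ (t - p l) * s) * vol (X' l).
      by rewrite !mulr_ge0 ?exprn_ge0 ?card_ge0// ltW.
    by lra.
  have := X'far l pt tl => X's.
  have -> : (t.+1 - p l = t - p l)%N by move: pt; clear; lia.
  have lossX : loss (n + t)%:R * vol (X l) <= 1 / 6 * vol (X l).
    by rewrite ler_wpM2r ?card_ge0.
  apply: le_trans (_ : 3 ^+ t * s ^+ (t - p l) * (3 * vol (X' l)) <= _).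
    by rewrite ler_wpM2l ?mulr_ge0 ?exprn_ge0 ?(ltW s0)//; lra.
  by rewrite exprS le_eqVlt; apply/orP; left; apply/eqP; ring.
- move=> j l w /andP[tj jp] ln wX'.
  have pl : (p l <= l)%N by case/andP: (block_itv bs ln).
  have jl : (j < l)%N := leq_trans jp pl.
  have tjn : (t < j < n)%N by rewrite tj (ltn_trans jl).
  have tln : (t < l < n)%N by rewrite ln (ltn_trans tj).
  have Xl' := X'far l (ltn_trans tj jp) tln.
  (* [X' l] lies in the [E]-neighbourhood of [x], and [w] is not spoiled, so its [bl]-neighbourhood
     is roughly halved as well. *)
  have degX' : deg bl w (X' l) <= deg bl w (X l) / 2 + vol (X l) / s.
    rewrite [vol (X l) / s]mulrC.
    apply: le_trans (_ : deg (E (adjT l)) x (nbhd bl w (X l)) <= _).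
      apply/card_subset/subsetP => y; rewrite !inE.
      by move=> /andP[/andP[_ /andP[-> /FE->]] ->].
    move: wX'; rewrite !inE => /andP[+ /andP[wX _]]; apply: contraR.
    rewrite -ltNge => lt; apply/bigcupP; exists (Ordinal ln).
      exact: (ltn_trans tj).
    by rewrite !inE wX.
  have := @pe_sparse _ _ _ pe j l w; rewrite (ltnW tj) jp => /(_ isT ln).
  move=> /(_ (subsetP (X'sub j) _ wX')) degX; rewrite addnS -natr1.
  have N2 : 0 <= 32 * n%:R ^+ 2 :> R by rewrite mulr_ge0// exprn_ge0.
  have b1 := ler_wpM2l N2 degX'.
  have e1 : 32 * n%:R ^+ 2 * (vol (X l) / s) = vol (X l) / 8.
    by rewrite /scale; field; rewrite gt_eqF.
  have q1 : 0 <= (n + t)%:R + 1 :> R by lra.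
  have b2 := ler_wpM2l q1 Xl'.
  have b3 : ((n + t)%:R + 1) * loss (n + t)%:R * vol (X l)
      <= 9 / 64 * vol (X l).
    by rewrite ler_wpM2r ?card_ge0.
  have X0 : 0 <= vol (X l) := card_ge0 _.
  lra.
Qed.

End Step.

Lemma exists_embedding : exists v : nat -> T,
  forall i j, (i < j < n)%N -> F (hadj i j) (v i) (v j).
Proof.
have /card_gt0P[x0 _] : (0 < #|V 0%N|)%N.
  by rewrite -(@ltr0n R); apply: lt_le_trans mu_gt0 (block_large bs n_gt0).
suff [v [X [emb _ _ _ _]]] : exists v X, partial_embedding n v X by exists v.
have : (n <= n)%N by []; elim: {1 3}n => [_|t IH tn].
  by exists (fun=> x0), V; apply: partial_embedding0.
by have [v [X]] := IH (ltnW tn); apply: partial_embedding_step.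
Qed.
End Embedding.

(** * Jumbledness of pseudo-random graphs *)

Section PseudoRandom.
Context {R : realType} {G : sgraph}.
Local Notation vol := (@cardR R G).
Local Notation deg := (@deg R G).
Implicit Types A B : {set G}.

Definition adjacency (a : bool) : rel G :=
  fun x y => (x != y) && (adj x y == a).

Lemma sum_deg_adj A B :
  \sum_(x in A) deg (@adj G) x B = (edge_pairs A B)%:R.
Proof.
under eq_bigr do rewrite deg_sum.
rewrite /edge_pairs -sum1_card natr_sum pair_big_dep /=.
rewrite big_mkcond [RHS]big_mkcond; apply: eq_bigr => -[x y] _ /=.
by rewrite !inE /=; case: (x \in A); case: (y \in B); case: (adj x y).
Qed.

Lemma sum_deg_nonadj A B : \sum_(x in A) deg (adjacency false) x B
  = vol A * vol B - (edge_pairs A B)%:R - vol (A :&: B).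
Proof.
have eqAB : vol (A :&: B) = \sum_(x in A) deg (fun x y => x == y) x B.
  rewrite card_sum1 big_mkcond [RHS]big_mkcond; apply: eq_bigr => x _.
  rewrite inE; case: (x \in A) => //=.
  have -> : deg (fun x y => x == y) x B
      = #|if x \in B then [set x] else set0|%:R.
    congr (_%:R); apply: eq_card => y; rewrite inE.
    case: eqVneq => [<-|xy]; first by case: ifP; rewrite inE ?eqxx.
    by rewrite andbF; case: ifP; rewrite inE // eq_sym (negPf xy).
  by case: ifP; rewrite ?cards1 ?cards0.
rewrite eqAB -sum_deg_adj mulrC -sum_const_card -!sumrB; apply: eq_bigr => x _.
rewrite !deg_sum card_sum1 -!sumrB; apply: eq_bigr => y _.
rewrite /adjacency; case: eqVneq => [->|_] /=.
  by rewrite adj_irrefl !subr0 subrr.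
by case: (adj x y); rewrite !subr0 ?subrr.
Qed.

Variables (lambda : R).
Hypotheses (G_gt0 : (0 < #|G|)%N) (prG : pseudo_random (1 / 2) lambda G).

Lemma pseudo_random_edge_pairs A B :
  `|(edge_pairs A B)%:R - vol A * vol B / 2|
    <= lambda * Num.sqrt (vol A * vol B).
Proof.
have [A0|A0] := eqVneq A set0.
  have -> : edge_pairs A B = 0%N.
    apply/eqP; rewrite cards_eq0; apply/eqP/setP => -[x y].
    by rewrite !inE A0 inE.
  by rewrite A0 /cardR cards0 !mul0r subrr normr0 sqrtr0 mulr0.
have [B0|B0] := eqVneq B set0.
  have -> : edge_pairs A B = 0%N.
    apply/eqP; rewrite cards_eq0; apply/eqP/setP => -[x y].
    by rewrite !inE B0 inE andbF.
  by rewrite B0 /cardR cards0 mulr0 !mul0r subrr normr0 sqrtr0 mulr0.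
have := prG A0 B0; rewrite /density natrM -/(vol A) -/(vol B).
have AB0 : 0 < vol A * vol B by rewrite mulr_gt0 ?ltr0n ?card_gt0.
have sAB : 0 < Num.sqrt (vol A * vol B) by rewrite sqrtr_gt0.
rewrite ler_pdivlMr//; move: AB0 sAB; set m := vol A * vol B => m0 sm0 le1.
have -> : (edge_pairs A B)%:R - m / 2 = ((edge_pairs A B)%:R / m - 1 / 2) * m.
  by field; rewrite gt_eqF.
rewrite normrM (gtr0_norm m0) -{2}(sqr_sqrtr (ltW m0)) expr2 mulrA.
by rewrite ler_pM2r.
Qed.

(** A vertex has density 0 to itself. The bound makes [lambda] positive and absorbs diagonal
    terms. *)
Lemma pseudo_random_ge_half : 1 / 2 <= lambda.
Proof.
have /card_gt0P[x _] := G_gt0; have := pseudo_random_edge_pairs [set x] [set x].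
have -> : edge_pairs [set x] [set x] = 0%N.
  apply/eqP; rewrite cards_eq0; apply/eqP/setP => -[y z].
  rewrite !inE /=; case: eqVneq => //= ->; case: eqVneq => //= ->.
  by rewrite adj_irrefl.
by rewrite /cardR cards1 mulr1 sqrtr1 mulr1 sub0r normrN ger0_norm ?divr_ge0.
Qed.

(** Non-adjacency loses the diagonal of [A :&: B], of size at most [r] and so at most
    [2 * lambda * r]; hence the factor 3. *)
Lemma adjacency_jumbled a : jumbled (3 * lambda) (adjacency a).
Proof.
move=> A B; have := pseudo_random_edge_pairs A B.
have l2 := pseudo_random_ge_half; set r := Num.sqrt _ => eAB.
have r0 : 0 <= r by apply: sqrtr_ge0.
have r2 : r ^+ 2 = vol A * vol B by rewrite sqr_sqrtr// mulr_ge0.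
have iAB : vol (A :&: B) <= r.
  have i0 : 0 <= vol (A :&: B) := card_ge0 _.
  rewrite -(ler_sqr i0 r0) r2 expr2 ler_pM//; apply: card_subset.
    exact: subsetIl.
  exact: subsetIr.
suff : `|\sum_(x in A) deg (adjacency a) x B - vol A * vol B / 2|
    <= 3 * lambda * r.
  move=> H; rewrite -[X in _ <= _ * X]r2 -exprMn -[leLHS]real_normK ?num_real//.
  by rewrite lerXn2r ?nnegrE// !mulr_ge0//; lra.
case: a.
  have -> : \sum_(x in A) deg (adjacency true) x B = (edge_pairs A B)%:R.
    rewrite -sum_deg_adj; apply: eq_bigr => x _; congr (_%:R).
    apply: eq_card => y.
    rewrite !inE /adjacency eqb_id; case: eqVneq => // ->.
    by rewrite adj_irrefl.
  apply: le_trans eAB _; rewrite ler_wpM2r//; lra.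
rewrite sum_deg_nonadj; have := card_ge0 (R := R) (A :&: B).
have lr : r <= 2 * lambda * r by rewrite ler_peMl//; lra.
move: eAB; rewrite !ler_norml; lra.
Qed.

End PseudoRandom.

(** * From embedded sequences to induced monochromatic copies *)

Section InducedCopies.
Context {G : sgraph}.
Variables (col : edge_2coloring G) (k : bool).

Definition coloured_adj : rel G := fun x y => adj x y && (col [set x; y] == k).

Lemma coloured_adj_sym : symmetric coloured_adj.
Proof. by move=> x y; rewrite /coloured_adj adj_sym setUC. Qed.

Lemma mono_copy_of_embedding (H : sgraph) (f : H -> G) : injective f ->
  (forall x y, adj (f x) (f y) = adj x y) ->
  (forall x y, adj x y -> col [set f x; f y] = k) ->
  induced_mono_copy_in col k H.
Proof.
move=> f_inj f_adj f_col; pose S := [set f x | x in [set: H]].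
have fS x : f x \in S by apply: imset_f.
exists S; last first.
  by move=> _ _ /imsetP[x _ ->] /imsetP[y _ ->]; rewrite f_adj; apply: f_col.
pose g x : induced S := exist _ (f x) (fS x).
have g_inj : injective g by move=> x y [/f_inj].
have [|g' gK g'K] := inj_card_bij g_inj.
  by rewrite card_sig (eq_card (B := S))// card_imset// cardsT.
exists g'; first by exists g.
move=> x y; rewrite -{2}(g'K x) -{2}(g'K y); exact/esym/f_adj.
Qed.

Definition coloured_adjacency (a : bool) : rel G :=
  if a then coloured_adj else adjacency false.

Lemma mono_copy_of_sequence (n : nat) (H : sgraph) :
  (0 < #|H| <= n)%N ->
  (forall hadj : nat -> nat -> bool, exists v : nat -> G,
     forall i j, (i < j < n)%N -> coloured_adjacency (hadj i j) (v i) (v j)) ->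
  induced_mono_copy_in col k H.
Proof.
move=> /andP[/card_gt0P[x0 _] Hn].
(* The default [x0] pads the pattern up to length [n]; vertices embedded at indices beyond [#|H|]
   are discarded. *)
move=> /(_ (fun i j => adj (nth x0 (enum H) i) (nth x0 (enum H) j)))[v vP].
pose f (x : H) := v (enum_rank x).
have fP (x y : H) : (enum_rank x < enum_rank y)%N ->
    coloured_adjacency (adj x y) (f x) (f y).
  move=> xy; have := vP (enum_rank x) (enum_rank y); rewrite !nth_enum_rank.
  by apply; rewrite xy (leq_trans _ Hn).
have {}fP (x y : H) : x != y -> [/\ f x != f y, adj (f x) (f y) = adj x y
    & adj x y -> col [set f x; f y] = k].
  wlog xy : x y / (enum_rank x < enum_rank y)%N => [W|_].
    case: (ltngtP (enum_rank x) (enum_rank y)) => [/W//|/W + xy|].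
      rewrite eq_sym => /(_ xy)[? e c]; split; first by rewrite eq_sym.
        by rewrite adj_sym e adj_sym.
      by rewrite adj_sym setUC.
    by move=> /val_inj/enum_rank_inj -> /eqP.
  have := fP x y xy; rewrite /coloured_adjacency.
  case: (adj x y) => [/andP[a /eqP]|].
    split=> //; apply/eqP => e; move: a.
    by rewrite e adj_irrefl.
  by case/andP => ? /eqP.
apply: (@mono_copy_of_embedding H f).
- by move=> x y fxy; apply/eqP; apply: contraT => /fP[]; rewrite fxy eqxx.
- by move=> x y; have [->|/fP[]//] := eqVneq x y; rewrite !adj_irrefl.
- by move=> x y; have [->|/fP[]//] := eqVneq x y; rewrite adj_irrefl.
Qed.

End InducedCopies.

(** * Estimates of the constants and conclusion *)

Lemma ramsey_size_le {R : realFieldType} (n : nat) (mu : R) h :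
  (0 < n)%N -> 0 <= mu ->
  ramsey_size n mu h
    <= (4 * 9 ^+ n * scale n ^+ 2) ^+ h * scale n ^+ (3 * 2 ^ h) * mu.
Proof.
move=> n0 mu0; have s1 := @scale_ge1 R _ n0; have s0 := @scale_gt0 R _ n0.
elim: h => [|h IH] /=; first by rewrite expr0 mul1r ler_peMl// exprn_ege1.
have D0 d : 0 <= 2 * shrink n d :> R by rewrite mulr_ge0// ltW// shrink_gt0.
have DD0 := mulr_ge0 (D0 (2 ^ h.+1)%N) (D0 (2 ^ h)%N).
rewrite mulrA; apply: le_trans (ler_wpM2l DD0 IH) _.
(* The round adds [2 ^ h.+1 + 2 ^ h = 3 * 2 ^ h] to the exponent of [scale], which doubles it; two
   further factors [scale] belong to the base of the [h]-th power. *)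
rewrite le_eqVlt; apply/orP; left; apply/eqP; rewrite /shrink.
have -> : 9 ^+ n = (3 ^+ n) ^+ 2 :> R.
  by rewrite -exprM mulnC exprM expr2 -natrM.
set s := scale n; set a := s ^+ (2 ^ h).
have -> : s ^+ (2 ^ h).+1 = a * s by rewrite exprSr.
have -> : s ^+ (2 ^ h.+1).+1 = a ^+ 2 * s by rewrite exprSr expnSr exprM.
have -> : s ^+ (3 * 2 ^ h) = a ^+ 3 by rewrite mulnC exprM.
have -> : s ^+ (3 * 2 ^ h.+1) = a ^+ 6.
  have -> : (3 * 2 ^ h.+1 = 2 ^ h * 6)%N by rewrite expnS; lia.
  by rewrite exprM.
rewrite [_ ^+ h.+1]exprS; set b := _ ^+ h; set q := 3 ^+ n.
clearbody b q a s; ring.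
Qed.

Section Main.
Context {R : realType} {G : sgraph}.
Variables (h : nat) (lambda : R) (col : edge_2coloring G).
Hypotheses (h_gt0 : (0 < h)%N) (G_gt0 : (0 < #|G|)%N).
Hypothesis prG : pseudo_random (1 / 2) lambda G.
Hypothesis lambda_small : lambda * 2 ^+ (80 * 2 ^ h * h) <= #|G|%:R.
Local Notation n := (2 ^ h)%N.

Let n_gt0 : (0 < n)%N. Proof. by rewrite expn_gt0. Qed.

Lemma coloured_embedding : exists k, forall hadj : nat -> nat -> bool,
  exists v : nat -> G,
    forall i j, (i < j < n)%N ->
      coloured_adjacency col k (hadj i j) (v i) (v j).
Proof.
have l2 := pseudo_random_ge_half G_gt0 prG.
have s0 := @scale_gt0 R _ n_gt0.
pose L := 3 * lambda; have L0 : 0 < L by rewrite /L; lra.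
(* The least value that [L_small] allows. *)
pose mu := L * scale n ^+ 3 * (3 ^+ n * scale n ^+ n).
have mu0 : 0 < mu by rewrite mulr_gt0// mulr_gt0 ?exprn_gt0.
have EF k a (x y : G) : adjacency a x y ->
    coloured_adjacency col k a x y || coloured_adj col (~~ k) x y.
  case: a; last by rewrite /coloured_adjacency => ->.
  rewrite /coloured_adjacency /coloured_adj => /andP[_ /eqP->].
  by case: (col _); case: k.
have FE k a (x y : G) : coloured_adjacency col k a x y -> adjacency a x y.
  case: a => // /andP[xy _]; rewrite /adjacency xy eqxx andbT.
  by apply/eqP => e; move: xy; rewrite e adj_irrefl.
have emb k :
    has_blocks n mu (coloured_adj col k) (coloured_adj col (~~ k)) n [set: G] ->
    forall hadj : nat -> nat -> bool, exists v : nat -> G,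
    forall i j, (i < j < n)%N ->
      coloured_adjacency col k (hadj i j) (v i) (v j).
  move=> [V [p [c bs]]] hadj.
  exact: (exists_embedding n_gt0 mu0 (ltW L0) (adjacency_jumbled G_gt0 prG)
    (lexx mu) (FE k) (EF k) (fun _ _ xy => xy) bs).
suff : ramsey_size n mu h <= cardR [set: G].
  case/(ramsey_blocks n_gt0 mu0 (coloured_adj_sym col true)
     (coloured_adj_sym col false) (leqnn _)) => /emb.
    by exists true.
  by exists false.
rewrite /cardR cardsT; apply: le_trans lambda_small.
apply: le_trans (ramsey_size_le h n_gt0 (ltW mu0)) _.
have scaleE : scale n = 2 ^+ (8 + 2 * h) :> R.
  have -> : 2 ^+ (8 + 2 * h) = 2 ^+ 8 * (2 ^+ h) ^+ 2 :> R.
    by rewrite exprD mulnC exprM.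
  by rewrite /scale natrX -(natrX R 2 8).
rewrite /mu /L.
set X := 4 * 9 ^+ n * scale n ^+ 2.
have -> : X ^+ h * scale n ^+ (3 * n)
    * (3 * lambda * scale n ^+ 3 * (3 ^+ n * scale n ^+ n))
  = lambda * (X ^+ h * scale n ^+ (3 * n)
    * (3 * scale n ^+ 3 * (3 ^+ n * scale n ^+ n))) by ring.
rewrite ler_pM2l; last by lra.
have nine_le : 9 ^+ n <= 2 ^+ (4 * n) :> R.
  by rewrite exprM; apply: lerXn2r; rewrite ?nnegrE ?exprn_ge0// -natrX ler_nat.
have X0 : 0 <= X by rewrite !mulr_ge0 ?exprn_ge0// ltW.
have X_le : X ^+ h <= 2 ^+ ((2 + 4 * n + (8 + 2 * h) * 2) * h).
  rewrite (exprM 2 (2 + 4 * n + (8 + 2 * h) * 2)).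
  apply: lerXn2r; rewrite ?nnegrE ?exprn_ge0// /X scaleE.
  rewrite (exprD 2 (2 + 4 * n)) (exprD 2 2) (exprM 2 (8 + 2 * h)).
  by rewrite ler_wpM2r ?exprn_ge0// (_ : 4 = 2 ^+ 2) ?ler_wpM2l// -natrX.
have three_le : 3 ^+ n <= 2 ^+ (2 * n) :> R.
  by rewrite exprM; apply: lerXn2r; rewrite ?nnegrE ?exprn_ge0// -natrX ler_nat.
apply: (@le_trans _ _ (2 ^+ ((2 + 4 * n + (8 + 2 * h) * 2) * h)
  * 2 ^+ ((8 + 2 * h) * (3 * n)) * (2 ^+ 2 * 2 ^+ ((8 + 2 * h) * 3)
  * (2 ^+ (2 * n) * 2 ^+ ((8 + 2 * h) * n))))).
  rewrite scaleE -!(exprM 2).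
  have p2 e : 0 <= 2 ^+ e :> R by exact: exprn_ge0.
  have p3 : 0 <= 3 ^+ n :> R by exact: exprn_ge0.
  have three4 : 3 <= 2 ^+ 2 :> R by rewrite -(natrX R 2 2) ler_nat.
  apply: ler_pM.
  - exact: mulr_ge0 (exprn_ge0 _ X0) (p2 _).
  - exact: mulr_ge0 (mulr_ge0 (ler0n _ 3) (p2 _)) (mulr_ge0 p3 (p2 _)).
  - exact: ler_wpM2r (p2 _) _ _ X_le.
  - apply: ler_pM.
    + exact: mulr_ge0 (ler0n _ 3) (p2 _).
    + exact: mulr_ge0 p3 (p2 _).
    + exact: ler_wpM2r (p2 _) _ _ three4.
    + exact: ler_wpM2r (p2 _) _ _ three_le.
(* The exponents add up to [4 * h ^ 2 + 12 * n * h + 24 * h + 34 * n + 26], which is at most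
   [80 * n * h] because [1 <= h < n]. *)
rewrite -!exprD ler_weXn2l ?ler1n//.
have hn : (h < n)%N by apply: ltn_expl.
nia.
Qed.

End Main.

Lemma trunc_log2_le_log2 {R : realType} (n : nat) :
  (0 < n)%N -> (trunc_log 2 n)%:R <= log2 n%:R :> R.
Proof.
move=> n0; have ln2 : 0 < ln 2 :> R by rewrite ln_gt0// ltr1n.
rewrite /log2 ler_pdivlMr// mulr_natl -lnXn// ler_ln ?posrE ?exprn_gt0 ?ltr0n//.
by rewrite -natrX ler_nat trunc_logP.
Qed.

(** Here [2 ^ h <= 2 * n] and, as [1 < n], [h <= 2 * trunc_log 2 n], so 80 becomes 320. *)
Lemma pow2_le_powR {R : realType} (n : nat) (h := (trunc_log 2 n).+1) :
  (1 < n)%N -> 2 ^+ (80 * 2 ^ h * h) <= 2 `^ (320 * n%:R * log2 n%:R) :> R.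
Proof.
move=> n1; have n0 := ltnW n1; have tl := @trunc_log2_le_log2 R n n0.
have t1 : (0 < trunc_log 2 n)%N by rewrite trunc_log_gt0 n1.
have tn := trunc_logP (isT : (1 < 2)%N) n0.
rewrite -powR_mulrn// ler_powR ?ler1n//.
apply: (@le_trans _ _ (320 * n * trunc_log 2 n)%:R).
  rewrite ler_nat /h expnS; set t := trunc_log 2 n in t1 tn *.
  by nia.
by rewrite !natrM ler_wpM2l// mulr_ge0.
Qed.

Lemma mono_copy_card_le1 (G H : sgraph) (col : edge_2coloring G) k :
  (0 < #|G|)%N -> (#|H| <= 1)%N -> induced_mono_copy_in col k H.
Proof.
move=> /card_gt0P[g _] /fintype_le1P H1.
apply: (@mono_copy_of_embedding G col k H (fun=> g)) => x y.
- by rewrite (H1 x y).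
- by rewrite (H1 x y) !adj_irrefl.
- by rewrite (H1 x y) adj_irrefl.
Qed.

Theorem theorem1p3 (R : realType) :
  exists c : R,
    forall (n N : nat) (G : sgraph) (lambda : R),
      (0 < N)%N -> #|G| = N ->
      pseudo_random (1 / 2) lambda G ->
      lambda <= 2 `^ (- (c * n%:R * log2 n%:R)) * N%:R ->
      forall col : edge_2coloring G,
        (forall H : sgraph, #|H| = n -> induced_mono_copy col H) /\
        (exists k : bool,
           forall H : sgraph, #|H| = n -> induced_mono_copy_in col k H).
Proof.
exists 320 => n N G lambda N0 GN prG lambda_le col.
suff [k copies] : exists k : bool,
    forall H : sgraph, #|H| = n -> induced_mono_copy_in col k H.
  by split; [move=> H /copies; exists k|exists k].
have G0 : (0 < #|G|)%N by rewrite GN.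
(* A graph on at most one vertex has no edge, so any colour serves; the estimate by [trunc_log 2 n]
   needs [1 < n]. *)
have [n1|n1] := leqP n 1.
  by exists true => H Hn; apply: mono_copy_card_le1; rewrite ?Hn.
(* Capacities are powers of two, so [n] is rounded up to [2 ^ h]. *)
pose h := (trunc_log 2 n).+1.
have lambda_small : lambda * 2 ^+ (80 * 2 ^ h * h) <= #|G|%:R.
  have P0 : 0 < 2 `^ (320 * n%:R * log2 n%:R) :> R by rewrite powR_gt0.
  move: lambda_le; rewrite powRN mulrC ler_pdivlMr// GN; apply: le_trans.
  rewrite ler_wpM2l ?pow2_le_powR//.
  by have := pseudo_random_ge_half G0 prG; lra.
have [k emb] := coloured_embedding col (ltn0Sn _) G0 prG lambda_small.
exists k => H Hn; apply: mono_copy_of_sequence emb; rewrite Hn (ltnW n1)/=.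
exact/ltnW/trunc_log_ltn.
Qed.
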